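(* Let $S$ be a starlike tree with central vertex $v_0$ and $\ell$ leaves $v_1,v_2,\dots,v_\ell$. If $(\mathbf{d},\mathbf{r})$ is an arithmetical structure on $S$, then \[\mathcal{K}(S;\mathbf{d},\mathbf{r})\oplus(\mathbb{Z}/r_0\mathbb{Z})^2\cong\bigoplus_{i=1}^\ell\mathbb{Z}/d^*_i\mathbb{Z},\] where $r_0=\mathbf{r}(v_0)$, $r_i=\mathbf{r}(v_i)$ and $d^*_i=r_0/r_i$.
   Context: A starlike tree is a tree with exactly one vertex of degree at least $3$ (its central vertex). An arithmetical structure on $S$ is a pair $(\mathbf{d},\mathbf{r})$ with $\mathbf{d}\in\mathbb{Z}_{\ge0}^{V(S)}$, $\mathbf{r}\in\mathbb{Z}_{>0}^{V(S)}$ whose entries have no nontrivial common factor, and $(\operatorname{diag}(\mathbf{d})-A(S))\mathbf{r}=\mathbf{0}$, where $A(S)$ is the adjacency matrix. The critical group $\mathcal{K}(S;\mathbf{d},\mathbf{r})$ is the torsion subgroup of $\mathbb{Z}^{V(S)}/\operatorname{im}(\operatorname{diag}(\mathbf{d})-A(S))$. *)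

(* Defs.v *)
From HB Require Import structures.
From mathcomp Require Import all_boot all_algebra.
From mathcomp Require Import boolp.
Set Implicit Arguments.
Unset Strict Implicit.
Unset Printing Implicit Defensive.
Import GRing.Theory.
Local Open Scope ring_scope.

(* A simple graph on a finite vertex type is a symmetric irreflexive relation. *)
Definition simple_graph (V : finType) (e : rel V) : Prop :=
  symmetric e /\ irreflexive e.

Definition degree (V : finType) (e : rel V) (v : V) : nat := #|[set w | e v w]|.

Definition leaf (V : finType) (e : rel V) (v : V) : bool := degree e v == 1%N.

(* [ucycle] also accepts the empty sequence and, on an edge x -- y, the
   sequence [:: x; y]; a graph-theoretic cycle has at least 3 vertices. *)
Definition tree (V : finType) (e : rel V) : Prop :=
  [/\ simple_graph e,
      forall x y : V, connect e x y &
      forall c : seq V, ucycle e c -> (size c < 3)%N].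

Definition starlike_tree (V : finType) (e : rel V) (v0 : V) : Prop :=
  tree e /\ forall v : V, (3 <= degree e v)%N = (v == v0).

(* Vectors and matrices indexed by V are indexed by 'I_#|V| through the
   enumeration [enum_val] of V. *)
Definition vertex_col (V : finType) (f : V -> nat) : 'cV[int]_#|V| :=
  \col_i (f (enum_val i))%:Z.

Definition adjacency_mx (V : finType) (e : rel V) : 'M[int]_#|V| :=
  \matrix_(i, j) (e (enum_val i) (enum_val j))%:Z.

Definition laplacian_mx (V : finType) (e : rel V) (d : V -> nat) :
    'M[int]_#|V| :=
  diag_mx (vertex_col d)^T - adjacency_mx e.

Definition arithmetical_structure (V : finType) (e : rel V) (d r : V -> nat) :
    Prop :=
  [/\ forall v : V, (0 < r v)%N,
      \big[gcdn/0%N]_(v : V) r v = 1%N &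
      laplacian_mx e d *m vertex_col r = 0].

Definition mx_im n (M : 'M[int]_n) : {pred 'cV[int]_n} :=
  fun y => `[< exists x : 'cV[int]_n, y = M *m x >].

Fact mx_im_zmod_closed n (M : 'M[int]_n) : zmod_closed (mx_im M).
Proof.
split=> [|_ _ /asboolP[x ->] /asboolP[y ->]]; apply/asboolP.
  by exists 0; rewrite mulmx0.
by exists (x - y); rewrite mulmxBr.
Qed.

HB.instance Definition _ n (M : 'M[int]_n) :=
  GRing.isZmodClosed.Build 'cV[int]_n (mx_im M) (mx_im_zmod_closed M).

(* [Quotient.quot I] is the quotient group for any additive subgroup I; no ring
   structure is used. *)
Definition mx_coker n (M : 'M[int]_n) : zmodType := Quotient.quot (mx_im M).

Definition torsion (G : zmodType) : {pred G} :=
  fun x => `[< exists2 n : nat, (0 < n)%N & x *+ n = 0 >].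

Fact torsion_zmod_closed (G : zmodType) : zmod_closed (@torsion G).
Proof.
split=> [|x y /asboolP[m m0 xm] /asboolP[n n0 yn]]; apply/asboolP.
  by exists 1%N.
exists (m * n)%N; first by rewrite muln_gt0 m0.
by rewrite mulrnBl mulrnA xm mul0rn mulnC mulrnA yn mul0rn subrr.
Qed.

HB.instance Definition _ (G : zmodType) :=
  GRing.isZmodClosed.Build G (@torsion G) (torsion_zmod_closed G).

Definition torsion_subgroup (G : zmodType) : Type := {x : G | x \in @torsion G}.

HB.instance Definition _ (G : zmodType) := SubChoice.on (torsion_subgroup G).
HB.instance Definition _ (G : zmodType) :=
  [SubChoice_isSubZmodule of torsion_subgroup G by <:].

(* The critical group does not depend on r, which is determined by d for an
   arithmetical structure. *)
Definition critical_group (V : finType) (e : rel V) (d r : V -> nat) :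
    zmodType :=
  torsion_subgroup (mx_coker (laplacian_mx e d)).

(* [dvdz n] is the subgroup nZ of Z. The type 'Z_n is not used because 'Z_1 is
   the two-element group. *)
Definition Zmod (n : nat) : zmodType := Quotient.quot (dvdz n : {pred int}).

Section DirectSum.
Variables (I : finType) (G : I -> zmodType).

Definition dsum : Type := {dffun forall i : I, G i}.
HB.instance Definition _ := Choice.on dsum.

Let zero : dsum := [ffun i => 0 : G i].
Let opp (f : dsum) : dsum := [ffun i => - f i : G i].
Let add (f g : dsum) : dsum := [ffun i => f i + g i : G i].

Fact dsum_addA : associative add.
Proof. by move=> f g h; apply/ffunP=> i; rewrite !ffunE addrA. Qed.
Fact dsum_addC : commutative add.
Proof. by move=> f g; apply/ffunP=> i; rewrite !ffunE addrC. Qed.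
Fact dsum_add0 : left_id zero add.
Proof. by move=> f; apply/ffunP=> i; rewrite !ffunE add0r. Qed.
Fact dsum_addN : left_inverse zero opp add.
Proof. by move=> f; apply/ffunP=> i; rewrite !ffunE addNr. Qed.

HB.instance Definition _ :=
  GRing.isZmodule.Build dsum dsum_addA dsum_addC dsum_add0 dsum_addN.
End DirectSum.

Definition group_iso (G H : zmodType) : Prop :=
  exists f : {additive G -> H}, bijective f.

(* Main.v *)
(* Let [x_w] be the class of the vertex [w] in the cokernel of the Laplacian.
   The columns of the vertices of an arm, read from the leaf [v j] inwards, give
   [x_w = (r w / r (v j)) x_(v j)] on the arm and
   [x_(v0) = (r v0 / r (v j)) x_(v j)], exactly as for [r] itself. Hence the
   cokernel modulo [x_(v0)] is [G / <b>], where [G] is the sum of the groups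
   [Z / (r v0 / r (v j))] and the [j]-th entry of [b] is [r w / r (v j)] for the
   neighbour [w] of [v0] on arm [j]. Since the values of [r] have no common
   factor, [x_(v0)] is [r v0] times an element [y] on which [r], seen as a
   linear form, takes the value [1], so that [G / <b>] is the sum of the
   critical group and [Z / r v0]. For the same reason some morphism
   [G -> Z / r v0] maps [b] to [1], so that [G] is the sum of [G / <b>] and
   [Z / r v0]. *)
Require Import Defs.
From HB Require Import structures.
From mathcomp Require Import all_boot all_algebra.
From mathcomp Require Import boolp zify ring.
Import GRing.Theory.

(** * Quotients, direct sums and ideals of the integers *)

Section AbelianGroups.
Set Implicit Arguments.
Unset Strict Implicit.
Local Open Scope ring_scope.
Local Open Scope quotient_scope.

(** A relation between representatives suffices to define an isomorphism: the kernel condition on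
    [B] makes any choice function additive, and the one on [A] makes it injective. *)
Lemma group_iso_relation (A B : zmodType) (R : A -> B -> Prop) :
  (forall a, exists b, R a b) -> (forall b, exists a, R a b) ->
  (forall a a' b b', R a b -> R a' b' -> R (a - a') (b - b')) ->
  (forall b, R 0 b -> b = 0) -> (forall a, R a 0 -> a = 0) ->
  group_iso A B.
Proof.
move=> /choice[f Rf] /choice[g Rg] RB R0b Ra0.
have fB : {morph f : x y / x - y >-> x - y}.
  move=> x y; apply/eqP; rewrite -subr_eq0; apply/eqP/R0b.
  by rewrite -(subrr (x - y)); apply: (RB) => //; apply: (RB).
pose F : {additive A -> B} := HB.pack f (GRing.isZmodMorphism.Build A B f fB).
exists F, g => [a|b] /=; apply/eqP; rewrite -subr_eq0; apply/eqP.
  by apply: Ra0; rewrite -(subrr (f a)); apply: (RB).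
by apply: R0b; rewrite -(subrr (g b)); apply: (RB).
Qed.

Definition quot_class (G : zmodType) (I : zmodClosed G) (x : G) :
  (Quotient.quot I : zmodType) := \pi x.

Fact quot_class_is_zmod_morphism (G : zmodType) (I : zmodClosed G) :
  zmod_morphism (@quot_class G I).
Proof. exact: raddfB. Qed.

HB.instance Definition _ (G : zmodType) (I : zmodClosed G) :=
  GRing.isZmodMorphism.Build G (Quotient.quot I) (@quot_class G I)
    (@quot_class_is_zmod_morphism G I).

Lemma quot_class_eq0 (G : zmodType) (I : zmodClosed G) (x : G) :
  quot_class I x = 0 <-> x \in I.
Proof.
rewrite -[x in x \in _]subr0 Quotient.idealrBE -(rwP eqP).
by rewrite [\pi 0]raddf0.
Qed.

Lemma quot_classP (G : zmodType) (I : zmodClosed G) (a : Quotient.quot I) :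
  exists x, a = quot_class I x.
Proof. by exists (repr a); rewrite /quot_class reprK. Qed.

Definition coker_class n (M : 'M[int]_n) (z : 'cV[int]_n) : mx_coker M :=
  quot_class (mx_im M) z.

Fact coker_class_is_zmod_morphism n (M : 'M[int]_n) :
  zmod_morphism (coker_class M).
Proof. exact: (raddfB (quot_class (mx_im M))). Qed.

HB.instance Definition _ n (M : 'M[int]_n) :=
  GRing.isZmodMorphism.Build 'cV[int]_n (mx_coker M) (coker_class M)
    (@coker_class_is_zmod_morphism n M).

Lemma coker_class_eq0 n (M : 'M[int]_n) z :
  coker_class M z = 0 <-> exists x, z = M *m x.
Proof.
by split=> [/quot_class_eq0/asboolP|h] //; apply/quot_class_eq0/asboolP.
Qed.

Lemma dsum0E (I : finType) (G : I -> zmodType) i : (0 : dsum G) i = 0.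
Proof. by rewrite ffunE. Qed.

Lemma dsumBE (I : finType) (G : I -> zmodType) (f g : dsum G) i :
  (f - g) i = f i - g i.
Proof. by rewrite !ffunE. Qed.

(** [Q] is an ideal of the integers, so Bezout's identity keeps it closed under gcd; [Q 0] covers
    the empty gcd. *)
Lemma ideal_gcdn (Q : int -> Prop) (I : finType) (F : I -> nat) :
  (forall a b x y, Q x -> Q y -> Q (a * x + b * y)) -> Q 0 ->
  (forall i, Q (F i)) -> Q (\big[gcdn/0%N]_i F i).
Proof.
move=> Qlin Q0 QF; apply: (big_ind (fun n : nat => Q n)) => // m n Qm Qn.
by have [a [b]] := Bezoutz m n; rewrite /gcdz !absz_nat => <-; exact: Qlin.
Qed.

End AbelianGroups.

(** * Integer vectors indexed by vertices *)

Section VertexVectors.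
Set Implicit Arguments.
Unset Strict Implicit.
Variable V : finType.
Local Open Scope ring_scope.

Definition entry w (z : 'cV[int]_#|V|) : int := z (enum_rank w) 0.

Fact entry_is_zmod_morphism w : zmod_morphism (entry w).
Proof. by move=> x y; rewrite /entry !mxE. Qed.
HB.instance Definition _ w := GRing.isZmodMorphism.Build 'cV[int]_#|V| int
  (entry w) (entry_is_zmod_morphism w).

Lemma entryP x y : (forall w, entry w x = entry w y) -> x = y.
Proof. by move=> h; apply/colP => i; rewrite -(enum_valK i); exact: h. Qed.

Definition vertex_unit w : 'cV[int]_#|V| := delta_mx (enum_rank w) 0.

Lemma entry_unit u w : entry w (vertex_unit u) = (w == u)%:Z.
Proof.
by rewrite /entry mxE eqxx andbT (inj_eq enum_rank_inj); case: (w == u).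
Qed.

Lemma vertex_unit_sum z : z = \sum_w vertex_unit w *~ entry w z.
Proof.
apply: entryP => u; rewrite raddf_sum (bigD1 u) //= big1 => [|w wu].
  by rewrite raddfMz /= entry_unit eqxx /= mulrzz mul1r addr0.
by rewrite raddfMz /= entry_unit eq_sym (negPf wu) /= mul0rz.
Qed.

Definition weighted_sum (f : V -> nat) (z : 'cV[int]_#|V|) : int :=
  \sum_w (f w)%:Z * entry w z.

Fact weighted_sum_is_zmod_morphism f : zmod_morphism (weighted_sum f).
Proof.
move=> x y; rewrite /weighted_sum -sumrB; apply: eq_bigr => w _.
by rewrite raddfB mulrBr.
Qed.
HB.instance Definition _ f := GRing.isZmodMorphism.Build 'cV[int]_#|V| int
  (weighted_sum f) (weighted_sum_is_zmod_morphism f).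

Lemma weighted_sum_unit f w : weighted_sum f (vertex_unit w) = f w.
Proof.
rewrite /weighted_sum (bigD1 w) //= entry_unit eqxx mulr1 big1 ?addr0 //.
by move=> u /negPf uw; rewrite entry_unit uw mulr0.
Qed.

End VertexVectors.

(** * Arms of a starlike tree as paths from the center to a leaf *)

Section StarlikeTrees.
Local Open Scope quotient_scope.
Set Implicit Arguments.
Unset Strict Implicit.
Variables (V : finType) (e : rel V) (v0 : V).
Hypothesis hS : starlike_tree e v0.

(** The center is left out of [p], so position [j] of [v0 :: p] is reached after [j] edges. *)
Definition arm_path (p : seq V) :=
  [&& path e v0 p, uniq (v0 :: p) & leaf e (last v0 p)].

Let e_sym : symmetric e. Proof. by case: hS => -[[]]. Qed.
Let e_irr : irreflexive e. Proof. by case: hS => -[[]]. Qed.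

Lemma leaf_neq_center w : leaf e w -> w != v0.
Proof.
by rewrite /leaf => /eqP h; apply/eqP => wv; have := hS.2 w; rewrite h wv eqxx.
Qed.

Lemma degree_le2 w : w != v0 -> degree e w <= 2.
Proof. by move=> h; rewrite -ltnS ltnNge -/(2.+1 <= _) hS.2. Qed.

Lemma arm_path_center p : arm_path p -> v0 \notin p.
Proof. by case/and3P=> _ /= /andP[]. Qed.

Lemma arm_path_gt0 p : arm_path p -> 0 < size p.
Proof.
by case: p => // /and3P[_ _ /leaf_neq_center]; rewrite /= eqxx.
Qed.

Lemma arm_path_last p : arm_path p -> last v0 p \in p.
Proof. by move=> /arm_path_gt0; case: p => //= x s _; exact: mem_last. Qed.

Lemma mem_nth_cons p j : 0 < j <= size p -> nth v0 (v0 :: p) j \in p.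
Proof. by case: j => //= j h; rewrite mem_nth. Qed.

Lemma nth_cons_index p u : u \in p ->
  exists2 j, 0 < j <= size p & u = nth v0 (v0 :: p) j.
Proof. by case/(nthP v0) => i hi <-; exists i.+1. Qed.

(** Only [v0] has degree above 2, so the predecessor and successor on the path, which are distinct,
    exhaust the neighbors. *)
Lemma arm_path_nbr p j : arm_path p -> 0 < j < size p ->
  [set w | e (nth v0 (v0 :: p) j) w] =
    [set nth v0 (v0 :: p) j.-1; nth v0 (v0 :: p) j.+1].
Proof.
case: j => // j hp hj; have [/(pathP v0) ep up _] := and3P hp.
have pj : nth v0 (v0 :: p) j.+1 \in p by apply: mem_nth_cons => //; lia.
have e1 : e (nth v0 p j) (nth v0 (v0 :: p) j).
  by rewrite e_sym; apply: (ep j); lia.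
have e2 : e (nth v0 p j) (nth v0 p j.+1) by apply: (ep j.+1); lia.
apply/esym/eqP; rewrite eqEcard; apply/andP; split.
  by apply/subsetP => w; rewrite !inE => /orP[] /eqP ->.
apply: leq_trans (degree_le2 _) _.
  by apply: contraNneq (arm_path_center hp) => <-.
by rewrite cards2 nth_uniq //=; lia.
Qed.

Lemma arm_path_nbr_last p : arm_path p ->
  [set w | e (last v0 p) w] = [set nth v0 (v0 :: p) (size p).-1].
Proof.
move=> hp; have [/(pathP v0) ep _ /eqP lp] := and3P hp.
apply/esym/eqP; rewrite eqEcard cards1; apply/andP; split; last by rewrite -lp.
have := arm_path_gt0 hp; rewrite sub1set inE (last_nth v0).
by case: (size p) ep => //= n ep _; rewrite e_sym; apply: ep.
Qed.

(* The vertices of an arm path other than [v0] form a connected component of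
   the tree with [v0] removed. *)
Lemma arm_path_closed p u w : arm_path p -> u \in p -> e u w -> w != v0 ->
  w \in p.
Proof.
move=> hp /nth_cons_index[j /andP[j0 jp] uE] euw wv0.
have mem i : i <= size p -> w = nth v0 (v0 :: p) i -> w \in p.
  by case: i => [_ /eqP /negPn|i hi ->]; [rewrite wv0|apply: mem_nth_cons].
have [jlt|jge] := ltnP j (size p).
  have : w \in [set w | e u w] by rewrite inE.
  rewrite uE arm_path_nbr ?j0 // !inE => /orP[] /eqP; apply: mem; lia.
have jE : j = size p by apply/eqP; rewrite eqn_leq jp.
have : w \in [set w | e u w] by rewrite inE.
rewrite uE jE -last_nth arm_path_nbr_last // inE => /eqP; apply: mem; lia.
Qed.

Lemma arm_path_leaf p u : arm_path p -> u \in p -> leaf e u -> u = last v0 p.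
Proof.
move=> hp /nth_cons_index[j /andP[j0 jp] uE].
have [jlt|jge] := ltnP j (size p); last first.
  have -> : u = nth v0 (v0 :: p) (size p); last by rewrite (last_nth v0).
  by rewrite uE; congr nth; apply/eqP; rewrite eqn_leq jp.
have [_ up _] := and3P hp.
rewrite /leaf /degree uE arm_path_nbr ?j0 // cards2 nth_uniq //=; lia.
Qed.

(** The neighbors of [w] are next to it on [v0 :: p], where [v0] occurs only at position 0. *)
Lemma arm_path_nbr_center p w : arm_path p -> w \in p -> e v0 w ->
  w = nth v0 (v0 :: p) 1.
Proof.
move=> hp /nth_cons_index[j /andP[j0 jp] wE] ew.
have [_ up _] := and3P hp.
have h i : i <= size p -> v0 = nth v0 (v0 :: p) i -> i = 0.
  move=> hi /eqP; rewrite -[X in X == _]/(nth v0 (v0 :: p) 0) nth_uniq //=.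
  by move=> /eqP.
have : v0 \in [set u | e w u] by rewrite inE e_sym.
have [jlt|jge] := ltnP j (size p).
  rewrite {1}wE arm_path_nbr ?j0 // !inE => /orP[] /eqP /h hh.
    by rewrite wE; congr nth; lia.
  by have := hh _; lia.
have jE : j = size p by apply/eqP; rewrite eqn_leq jp.
rewrite {1}wE jE -last_nth arm_path_nbr_last // inE => /eqP /h hh.
by rewrite wE; congr nth; lia.
Qed.

(** Walking along [q] from [u] in either direction avoids [v0], hence never leaves [p] by
    [arm_path_closed]. *)
Lemma arm_path_sub p q u : arm_path p -> arm_path q -> u \in p -> u \in q ->
  {subset q <= p}.
Proof.
move=> hp hq up uq.
have [/(pathP v0) eq _ _] := and3P hq.
have walk j : j < size q -> (nth v0 q j \in p) = (nth v0 q 0 \in p).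
  elim: j => // j IH hj; rewrite -IH ?(ltnW hj) //.
  have ej : e (nth v0 q j) (nth v0 q j.+1) by apply: (eq j.+1).
  have nv i : i < size q -> nth v0 q i != v0.
    move=> hi; apply: contraNneq (arm_path_center hq) => <-; exact: mem_nth.
  apply/idP/idP => h; last by apply: arm_path_closed ej _ => //; exact: nv.
  by rewrite e_sym in ej; apply: arm_path_closed ej _ => //; apply: nv; lia.
case/(nthP v0): uq => i hi iu w /(nthP v0)[j hj <-].
by rewrite walk // -(walk i) // iu.
Qed.

Lemma arm_path_last_inj p q u : arm_path p -> arm_path q ->
  u \in p -> u \in q -> last v0 p = last v0 q.
Proof.
move=> hp hq up uq; apply/esym/arm_path_leaf => //; last by case/and3P: hq.
exact: (arm_path_sub hp hq up uq) (arm_path_last hq).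
Qed.

(* A maximal simple path from [v0] ends in a leaf, since another
   neighbour of its last vertex would close a cycle. *)
Lemma arm_path_through w : w != v0 -> exists2 p, arm_path p & w \in p.
Proof.
move=> wv0; have [[_ conn acyc] _] := hS.
have [p0 ep0 w0] := connectP (conn v0 w).
have [p [ep up wp]] : exists p, [/\ path e v0 p, uniq (v0 :: p) & w \in p].
  move: w0; case/shortenP: ep0 => p ep up _ wl; exists p; split=> //.
  have := mem_last v0 p; rewrite -wl inE => /orP[/eqP h|//].
  by rewrite h eqxx in wv0.
(* Induction on a bound for the room left to extend [p]. Since [v0 :: p] is simple, [size p < #|V|],
   which rules out the bound 0. *)
have [n hn] : exists n, #|V| - size p <= n by exists (#|V| - size p).
elim: n p hn ep up wp => [|n IH] p hn ep up wp.
  have := max_card (mem (v0 :: p)); rewrite (card_uniqP up) => h.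
  by move: hn; rewrite leqn0 subn_eq0 => /(leq_trans h); rewrite ltnn.
have [lp|nlp] := boolP (leaf e (last v0 p)).
  by exists p => //; rewrite /arm_path ep up lp.
case/lastP: p hn ep up wp nlp => [//|p u] hn ep up wp nlp.
rewrite last_rcons in nlp; rewrite rcons_path in ep; case/andP: ep => ep eu.
have [u' eu' nu'] : exists2 u', e u u' & u' != last v0 p.
  apply/exists_inP; apply: contraNT nlp; rewrite negb_exists_in.
  move=> /forall_inP H; rewrite /leaf /degree.
  rewrite (_ : [set _ | _] = [set last v0 p]) ?cards1 //.
  apply/setP => x; rewrite !inE; apply/idP/eqP => [/H|->].
    by rewrite negbK => /eqP.
  by rewrite e_sym.
have [iu'|nu''] := boolP (u' \in v0 :: rcons p u); last first.
  apply: (IH (rcons (rcons p u) u')).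
  - by move: hn; rewrite !size_rcons !leq_subLR addnS.
  - by rewrite !rcons_path ep eu last_rcons eu'.
  - by rewrite -rcons_cons rcons_uniq nu'' up.
  - by rewrite mem_rcons inE wp orbT.
exfalso; move: iu'; rewrite -rcons_cons mem_rcons inE.
rewrite (_ : u' == u = false) /=; last first.
  by apply/eqP => h; rewrite h e_irr in eu'.
move=> iu'; have es : sorted e (v0 :: p) by [].
rewrite -rcons_cons in up; rewrite -[last v0 p]/(last v0 (v0 :: p)) in eu nu'.
case/splitPr: iu' es eu up nu' => s1 s2.
rewrite last_cat /= => /cat_sorted2[_ /= es2] eu up nu'.
(* This cycle has at least 3 vertices: [s2] is nonempty because [u'] is not the predecessor of
   [u]. *)
have /acyc : ucycle e (rcons (u' :: s2) u).
  apply/andP; split.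
    by rewrite /= !rcons_path es2 eu last_rcons.
  by move: up; rewrite rcons_cat cat_uniq => /and3P[].
by case: s2 eu nu' {es2 up} => [|? ?]; rewrite /= ?size_rcons // eqxx.
Qed.

(** * Harmonic functions along an arm *)

Variables (l : nat) (v : 'I_l -> V) (d r : V -> nat).
Hypothesis v_inj : injective v.
Hypothesis v_leaf : forall w : V, leaf e w <-> exists i : 'I_l, v i = w.
Hypothesis hdr : arithmetical_structure e d r.

Local Open Scope ring_scope.

(** An arbitrary group of values lets [r] and the vertex classes in the cokernel be treated
    alike. *)
Definition harmonic (M : zmodType) (f : V -> M) :=
  forall w, w != v0 -> f w *+ d w = \sum_(w' | e w w') f w'.

Let r_gt0 w : (0 < r w)%N. Proof. by case: hdr. Qed.

Lemma laplacian_row (w : V) (x : 'cV[int]_#|V|) :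
  entry w (laplacian_mx e d *m x) =
    (d w)%:Z * entry w x - \sum_(w' | e w w') entry w' x.
Proof.
rewrite /entry /laplacian_mx mulmxBl mul_diag_mx !mxE enum_rankK; congr (_ - _).
rewrite (reindex (@enum_rank V)) /=; last exact/onW_bij/enum_rank_bij.
rewrite [RHS]big_mkcond; apply: eq_bigr => w' _.
by rewrite !mxE !enum_rankK; case: (e w w'); rewrite ?mul1r ?mul0r.
Qed.

Lemma structure_balanced w : (r w * d w = \sum_(w' | e w w') r w')%N.
Proof.
have [_ _ /(congr1 (entry w))] := hdr.
rewrite laplacian_row raddf0 /entry mxE enum_rankK => /eqP.
rewrite subr_eq0 => /eqP h; apply/eqP; rewrite -eqz_nat PoszM mulrC h.
apply/eqP.
rewrite -[LHS]/(_ : int) (big_morph Posz PoszD (erefl _)).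
by apply: eq_bigr => w' _; rewrite mxE enum_rankK.
Qed.

Lemma structure_harmonic : harmonic (fun w => (r w)%:Z).
Proof.
move=> w _; rewrite -(big_morph Posz PoszD (erefl _)) -structure_balanced.
by rewrite PoszM -mulr_natr natz.
Qed.

Lemma arm_path_harmonic p j : arm_path p -> (0 < j < size p)%N ->
  forall (M : zmodType) (f : V -> M), harmonic f ->
  f (nth v0 (v0 :: p) j.-1) + f (nth v0 (v0 :: p) j.+1) =
    f (nth v0 (v0 :: p) j) *+ d (nth v0 (v0 :: p) j).
Proof.
move=> hp hj M f hf; have [_ up _] := and3P hp.
rewrite hf; last first.
  apply: contraNneq (arm_path_center hp) => <-; apply: mem_nth_cons => //; lia.
rewrite -[RHS](eq_bigl _ _ (in_set _)) arm_path_nbr // big_setU1 ?big_set1 //.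
by rewrite inE nth_uniq //=; lia.
Qed.

Lemma arm_path_harmonic_last p : arm_path p ->
  forall (M : zmodType) (f : V -> M), harmonic f ->
  f (nth v0 (v0 :: p) (size p).-1) = f (last v0 p) *+ d (last v0 p).
Proof.
move=> hp M f hf; rewrite hf; last by case/and3P: hp => _ _ /leaf_neq_center.
by rewrite -[RHS](eq_bigl _ _ (in_set _)) arm_path_nbr_last // big_set1.
Qed.

(* Working back from the leaf, the relations at the vertices of an arm express
   every value of a harmonic function through its value at the leaf. *)
Lemma harmonic_arm p w : arm_path p -> w \in v0 :: p ->
  exists a : int, forall (M : zmodType) (f : V -> M), harmonic f ->
    f w = f (last v0 p) *~ a.
Proof.
move=> hp wp; pose Q i := (i <= size p)%N -> exists a : int,
  forall (M : zmodType) (f : V -> M), harmonic f ->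
    f (nth v0 (v0 :: p) (size p - i)) = f (last v0 p) *~ a.
(* The recurrence along the arm has order two, so two consecutive positions, counted from the leaf,
   are carried together. *)
suff QQ i : Q i /\ Q i.+1.
  have [i hi <-] := nthP v0 wp; have [] := QQ (size p - i)%N.
  by rewrite /Q subKn // => h _; apply: h; apply: leq_subr.
elim: i => [|i [IH1 IH2]].
  split=> _; first by exists 1 => M f _; rewrite subn0 -last_nth mulr1z.
  by exists (d (last v0 p)) => M f /(arm_path_harmonic_last hp); rewrite subn1.
split=> // hi; have [a ha] := IH1 (ltnW (ltnW hi)).
have [b hb] := IH2 (ltnW hi).
exists (b * d (nth v0 (v0 :: p) (size p - i.+1)) - a) => M f hf.
have hj : (0 < size p - i.+1 < size p)%N by lia.
have := arm_path_harmonic hp hj hf.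
rewrite (_ : (size p - i.+1).-1 = size p - i.+2)%N; last lia.
rewrite (_ : (size p - i.+1).+1 = size p - i)%N; last lia.
move=> /(canRL (addrK _)) ->.
by rewrite ha // hb // mulrzBr mulrzA pmulrn.
Qed.

(** The coefficient given by [harmonic_arm] is the same for all harmonic functions; testing it on
    [r] shows that it is the quotient of the two values of [r], and that this quotient is exact. *)
Lemma harmonic_arm_div p w : arm_path p -> w \in v0 :: p ->
  [/\ r w = (r w %/ r (last v0 p) * r (last v0 p))%N &
      forall (M : zmodType) (f : V -> M), harmonic f ->
        f w = f (last v0 p) *+ (r w %/ r (last v0 p))%N].
Proof.
move=> hp wp; have [a ha] := harmonic_arm hp wp.
have ra : (r w)%:Z = a * (r (last v0 p))%:Z.
  by have := ha _ _ structure_harmonic; rewrite mulrzz mulrC.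
have a0 : 0 <= a by have := r_gt0 w; have := r_gt0 (last v0 p); nia.
case: a a0 ha ra => // a _ ha [ra]; by rewrite ra mulnK.
Qed.

Lemma leaf_arm j : exists2 p, arm_path p & last v0 p = v j.
Proof.
have lj : leaf e (v j) by apply/v_leaf; exists j.
have [p hp jp] := arm_path_through (leaf_neq_center lj).
by exists p => //; rewrite (arm_path_leaf hp jp lj).
Qed.

(** Read outwards from [v0], the recurrence makes each value of [r] on an arm an integer combination
    of the two before it. *)
Lemma structure_spread (Q : int -> Prop) :
  (forall a b x y, Q x -> Q y -> Q (a * x + b * y)) ->
  Q (r v0) -> (forall w, e v0 w -> Q (r w)) -> forall w, Q (r w).
Proof.
move=> Qlin Q0 Q1 w; have [->//|wv0] := eqVneq w v0.
have [p hp /nth_cons_index[j]] := arm_path_through wv0.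
have p0 := arm_path_gt0 hp.
have QQ i : (0 < i <= size p)%N ->
    Q (r (nth v0 (v0 :: p) i.-1)) /\ Q (r (nth v0 (v0 :: p) i)).
  elim: i => // i IH /andP[_ hi]; have [i0|i0] := posnP i.
    rewrite i0 /=; split=> //; apply: Q1.
    by have /and3P[/(pathP v0) /(_ 0%N p0)] := hp.
  have [|Qi1 Qi] := IH; first by rewrite i0 ltnW.
  split=> //.
  have := @arm_path_harmonic p i hp _ _ _ structure_harmonic.
  rewrite i0 hi => /(_ isT) /(canRL (addKr _)) ->.
  rewrite addrC -mulr_natr mulrC -mulN1r; exact: Qlin.
by move=> /QQ[_ Qj] ->.
Qed.

(** * Arms indexed by their leaves, and the weights of their vertices *)

Definition in_arm j w :=
  `[< exists2 p, arm_path p & last v0 p = v j /\ w \in p >].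

Lemma in_arm_center j : in_arm j v0 = false.
Proof. by apply/asboolP => -[p /arm_path_center/negP hp []]. Qed.

Lemma in_arm_path j p w : arm_path p -> last v0 p = v j ->
  in_arm j w = (w \in p).
Proof.
move=> hp pl; apply/asboolP/idP => [[q hq [ql wq]]|wp]; last by exists p.
have vp := arm_path_last hp; have vq := arm_path_last hq.
by rewrite pl -ql in vp; apply: (arm_path_sub hp hq vp vq).
Qed.

(** The arms partition the vertices other than [v0]: two arm paths sharing a vertex end in the same
    leaf. *)
Lemma in_arm_unique w : w != v0 -> exists j, forall k, in_arm k w = (k == j).
Proof.
move=> wv0; have [p hp wp] := arm_path_through wv0.
have [j pj] : exists j, v j = last v0 p by apply/v_leaf; case/and3P: hp.
exists j => k; apply/asboolP/eqP => [[q hq [ql wq]]|->]; last by exists p.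
by apply: v_inj; rewrite pj -ql (arm_path_last_inj hp hq wp wq).
Qed.

Lemma in_arm_leaf j k : in_arm j (v k) = (j == k).
Proof.
have [q hq ql] := leaf_arm k; have qk : v k \in q by rewrite -ql arm_path_last.
apply/asboolP/eqP => [[p hp [pl kp]]|->]; last by exists q.
by apply: v_inj; rewrite -pl -ql (arm_path_last_inj hp hq kp qk).
Qed.

Lemma in_arm_edge j u w : e u w -> u != v0 -> w != v0 ->
  in_arm j u = in_arm j w.
Proof.
move=> euw u0 w0; have [p hp pl] := leaf_arm j; rewrite !(in_arm_path _ hp pl).
apply/idP/idP => h; first exact: arm_path_closed euw _.
by rewrite e_sym in euw; apply: arm_path_closed euw _.
Qed.

Lemma in_arm_center_nbr j :
  exists2 u, e v0 u & forall w, e v0 w -> in_arm j w = (w == u).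
Proof.
have [p hp pl] := leaf_arm j; have p0 := arm_path_gt0 hp.
exists (nth v0 (v0 :: p) 1) => [|w ew].
  by have /and3P[/(pathP v0) /(_ 0%N p0)] := hp.
rewrite (in_arm_path _ hp pl); apply/idP/eqP => [wp|->].
  exact: arm_path_nbr_center hp wp ew.
by apply: mem_nth_cons.
Qed.

Lemma in_arm_harmonic j w : in_arm j w || (w == v0) ->
  [/\ r w = (r w %/ r (v j) * r (v j))%N &
      forall (M : zmodType) (f : V -> M), harmonic f ->
        f w = f (v j) *+ (r w %/ r (v j))%N].
Proof.
have [p hp pl] := leaf_arm j; rewrite -pl (in_arm_path _ hp pl) => h.
by apply: harmonic_arm_div; rewrite // inE orbC.
Qed.

(** The coefficient of leaf [j] in the class of [w]. The center has weight 0 since its class is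
    accounted for separately. *)
Definition arm_weight j w := if in_arm j w then (r w %/ r (v j))%N else 0%N.
Definition arm_order j := (r v0 %/ r (v j))%N.

Lemma arm_weight_center j : arm_weight j v0 = 0%N.
Proof. by rewrite /arm_weight in_arm_center. Qed.

Lemma arm_weight_leaf j k : arm_weight j (v k) = (j == k).
Proof.
rewrite /arm_weight in_arm_leaf; case: eqP => // ->; by rewrite divnn r_gt0.
Qed.

Lemma arm_orderK j : (arm_order j * r (v j))%N = r v0.
Proof. by have [] := @in_arm_harmonic j v0; rewrite ?eqxx ?orbT. Qed.

Lemma harmonic_center j (M : zmodType) (f : V -> M) : harmonic f ->
  f v0 = f (v j) *+ arm_order j.
Proof.
have [|_ h] := @in_arm_harmonic j v0; first by rewrite eqxx orbT.
exact: h.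
Qed.

Lemma harmonic_arm_weight w (M : zmodType) (f : V -> M) :
  w != v0 -> harmonic f -> f w = \sum_j f (v j) *+ arm_weight j w.
Proof.
move=> /in_arm_unique[j hj] hf; rewrite (bigD1 j) //= big1 => [|k /negPf kj].
  rewrite addr0 /arm_weight hj eqxx; apply: (in_arm_harmonic _).2 => //.
  by rewrite hj eqxx.
by rewrite /arm_weight hj kj.
Qed.

(* Dividing the balance equation of [r] by [r (v j)]; the only term not
   accounted for is the one at [v0], which is [arm_order j]. *)
Lemma arm_weight_balanced j w : w != v0 ->
  (arm_weight j w * d w =
     \sum_(w' | e w w') arm_weight j w' %[mod arm_order j])%N.
Proof.
move=> w0; rewrite {1}/arm_weight; case: ifP => [wj|wj]; last first.
  rewrite mul0n big1 // => w' eww'; rewrite /arm_weight.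
  have [->|w'0] := eqVneq w' v0; first by rewrite in_arm_center.
  by rewrite -(in_arm_edge _ eww') // wj.
have -> : (r w %/ r (v j) * d w = \sum_(w' | e w w') r w' %/ r (v j))%N.
  apply/eqP; rewrite -(eqn_pmul2r (r_gt0 (v j))) mulnAC.
  have [<- _] := @in_arm_harmonic j w (introT orP (or_introl wj)).
  rewrite structure_balanced big_distrl; apply/eqP/eq_bigr => w' eww' /=.
  apply: (in_arm_harmonic _).1; have [//|w'0] := eqVneq w' v0; rewrite ?orbT //.
  by rewrite -(in_arm_edge _ eww') // wj.
rewrite -modn_summ -[in RHS]modn_summ; congr (_ %% _)%N.
apply: eq_bigr => w' eww'; rewrite /arm_weight.
have [->|w'0] := eqVneq w' v0; first by rewrite in_arm_center modnn mod0n.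
by rewrite -(in_arm_edge _ eww') // wj.
Qed.

(** * Bezout relations from the coprimality of [r] *)

Definition center_weight j := (\sum_(w | e v0 w) arm_weight j w)%N.

(** The leaf values generate an ideal containing every [r w]: off the center through the arm
    weights, and at [v0] because any leaf value divides [r v0]. *)
Lemma bezout_leaves : exists c : 'I_l -> int, \sum_j c j * (r (v j))%:Z = 1.
Proof.
pose Q x := exists c : 'I_l -> int, x = \sum_j c j * (r (v j))%:Z.
have Qlin a b x y : Q x -> Q y -> Q (a * x + b * y).
  move=> [c ->] [c' ->]; exists (fun j => a * c j + b * c' j).
  rewrite !mulr_sumr -big_split; apply: eq_bigr => j _.
  by rewrite mulrDl !mulrA.
have Q0 : Q 0.
  by exists (fun=> 0); rewrite big1 // => j _; rewrite mul0r.
suff [c] : Q 1 by exists c.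
have [_ r1 _] := hdr; rewrite -[1]/(Posz 1) -r1; apply: ideal_gcdn => // w.
have [->|w0] := eqVneq w v0; last first.
  exists (fun j => (arm_weight j w)%:Z).
  rewrite (harmonic_arm_weight w0 structure_harmonic).
  by apply: eq_bigr => j _; rewrite -mulr_natr natz mulrC.
(* An arm exists because the center has degree at least 3. *)
have /card_gt0P[u] : (0 < #|[set w | e v0 w]|)%N.
  by apply: (@leq_trans 3); rewrite // (hS.2 v0).
rewrite inE => euv; have /in_arm_unique[j _] : u != v0.
  by apply: contraTneq euv => ->; rewrite e_irr.
exists (fun k => if k == j then (arm_order j)%:Z else 0).
rewrite (bigD1 j) //= eqxx big1 => [|k /negPf ->]; last by rewrite mul0r.
by rewrite addr0 -PoszM arm_orderK.
Qed.

(** [r (v j) * center_weight j] is the value of [r] at the neighbor of [v0] on arm [j]. Together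
    with [r v0] these values generate all of [r] by [structure_spread], hence also 1. *)
Lemma bezout_center_weights : exists t : 'I_l -> int,
  ((\sum_j t j * (r (v j) * center_weight j)%N%:Z)%R = 1 %[mod r v0])%Z.
Proof.
pose Q (x : int) := exists t : 'I_l -> int,
  ((\sum_j t j * (r (v j) * center_weight j)%N%:Z)%R = x %[mod r v0])%Z.
suff : Q 1 by [].
have Qlin a b x y : Q x -> Q y -> Q (a * x + b * y).
  move=> [c hc] [c' hc']; exists (fun j => a * c j + b * c' j).
  rewrite -[in RHS]modzDm -[in RHS]modzMmr -hc.
  rewrite -[((b * y)%R %% _)%Z]modzMmr -hc'.
  rewrite modzMmr modzMmr modzDm !mulr_sumr -big_split; congr (_ %% _)%Z.
  by apply: eq_bigr => j _; rewrite mulrDl !mulrA.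
have Q0 n : (r v0 %| n)%Z -> Q n.
  move=> /dvdz_mod0P hn; exists (fun=> 0); by rewrite hn big1 ?mod0z.
have [_ r1 _] := hdr; rewrite -[1]/(Posz 1) -r1; apply: ideal_gcdn => //.
  exact: Q0.
apply: structure_spread => // [|w evw]; first exact: Q0.
have /in_arm_unique[j hj] : w != v0.
  by apply: contraTneq evw => ->; rewrite e_irr.
exists (fun k => (k == j)%:Z).
rewrite (bigD1 j) //= eqxx big1 => [|k /negPf ->]; last by rewrite mul0r.
rewrite addr0 mul1r (_ : center_weight j = r w %/ r (v j))%N.
  have [|rw _] := @in_arm_harmonic j w; last by rewrite mulnC -rw.
  by rewrite hj eqxx.
have [u eu hu] := in_arm_center_nbr j.
have wu : w = u by apply/eqP; rewrite -hu // hj.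
rewrite /center_weight (bigD1 w) //= big1 => [|w' /andP[ew' ww']].
  by rewrite /arm_weight hj eqxx addn0.
by rewrite /arm_weight hu // -wu (negPf ww').
Qed.

(** * The cokernel of the Laplacian and its torsion *)

Let L := laplacian_mx e d.

Lemma laplacian_self_adjoint (f : V -> int) x :
  \sum_w f w * entry w (L *m x) =
    \sum_w (f w * (d w)%:Z - \sum_(w' | e w w') f w') * entry w x.
Proof.
under eq_bigr do rewrite laplacian_row mulrBr.
under [RHS]eq_bigr do rewrite mulrBl.
rewrite !sumrB; congr (_ - _); first by apply: eq_bigr => w _; rewrite mulrA.
under eq_bigr do rewrite mulr_sumr.
under [RHS]eq_bigr do rewrite mulr_suml.
rewrite (exchange_big_dep xpredT) //=.
by apply: eq_bigr => w _; apply: eq_bigl => w'; rewrite e_sym.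
Qed.

Lemma weighted_sum_im x : weighted_sum r (L *m x) = 0.
Proof.
rewrite /weighted_sum laplacian_self_adjoint big1 // => w _.
rewrite -PoszM structure_balanced (big_morph Posz PoszD (erefl _)) subrr.
by rewrite mul0r.
Qed.

Definition arm_coord j := weighted_sum (arm_weight j).

(** Moving [L] onto the weights leaves only the term at [v0] modulo [arm_order j], by
    [arm_weight_balanced]. So the arm coordinates send the image of [L] into the multiples of
    [center_weight]. *)
Lemma arm_coord_im j x :
  (arm_order j %| arm_coord j (L *m x) + (center_weight j)%:Z * entry v0 x)%Z.
Proof.
rewrite /arm_coord /weighted_sum laplacian_self_adjoint (bigD1 v0) //=.
rewrite arm_weight_center mul0r sub0r mulNr -(big_morph Posz PoszD (erefl _)).
rewrite -/(center_weight j) addrAC addNr add0r.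
apply: rpred_sum => w w0; apply: dvdz_mulr.
rewrite -PoszM -(big_morph Posz PoszD (erefl _)) -eqz_mod_dvd !modz_nat.
by rewrite eqz_nat arm_weight_balanced.
Qed.

Definition vertex_class w := coker_class L (vertex_unit w).

Lemma vertex_class_sum z : coker_class L z = \sum_w vertex_class w *~ entry w z.
Proof.
rewrite {1}(vertex_unit_sum z) raddf_sum; apply: eq_bigr => w _.
by rewrite raddfMz.
Qed.

(** By symmetry of [e], the relation at [w] is column [w] of [L]. *)
Lemma vertex_class_harmonic : harmonic vertex_class.
Proof.
move=> w _; apply/eqP; rewrite -subr_eq0; apply/eqP.
rewrite /vertex_class -raddfMn -raddf_sum -raddfB; apply/coker_class_eq0.
exists (vertex_unit w); apply: entryP => u.
rewrite raddfB raddfMn raddf_sum /= laplacian_row !entry_unit.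
rewrite -mulr_natr natz.
under eq_bigr do rewrite entry_unit.
under [in RHS]eq_bigr do rewrite entry_unit.
congr (_ - _).
  by have [->|] := eqVneq u w; rewrite ?mul0r ?mulr0 ?mul1r ?mulr1.
have one x y : \sum_(w' | e x w') (y == w')%:Z = (e x y)%:Z.
  rewrite big_mkcond (bigD1 y) //= big1 => [|w' /negPf wy].
    by rewrite eqxx addr0; case: (e x y).
  by rewrite eq_sym wy if_same.
rewrite one e_sym -(one u w); apply: eq_bigr => w' _; by rewrite eq_sym.
Qed.

Variables (c t : 'I_l -> int).
Hypothesis c_sum : \sum_j c j * (r (v j))%:Z = 1.
Hypothesis t_sum :
  ((\sum_j t j * (r (v j) * center_weight j)%N%:Z)%R = 1 %[mod r v0])%Z.

(** The form [weighted_sum r] is 1 at [y], so the class of [y] generates a complement of the torsion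
    subgroup. *)
Let y : 'cV[int]_#|V| := \sum_j vertex_unit (v j) *~ c j.

Lemma weighted_sum_y : weighted_sum r y = 1.
Proof.
rewrite raddf_sum -[RHS]c_sum; apply: eq_bigr => j _.
by rewrite raddfMz /= weighted_sum_unit mulrzz mulrC.
Qed.

Lemma leaf_class_mul j :
  vertex_class (v j) *+ r v0 = vertex_class v0 *+ r (v j).
Proof.
by rewrite (harmonic_center j vertex_class_harmonic) -mulrnA arm_orderK.
Qed.

Lemma vertex_class_mul w : vertex_class w *+ r v0 = vertex_class v0 *+ r w.
Proof.
have [->//|w0] := eqVneq w v0.
rewrite (harmonic_arm_weight w0 vertex_class_harmonic) -sumrMnl.
rewrite [RHS]pmulrn (harmonic_arm_weight w0 structure_harmonic).
rewrite mulrz_sumr; apply: eq_bigr => j _.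
by rewrite mulrnAC leaf_class_mul -mulrnA -mulr_natr natz -PoszM -pmulrn.
Qed.

Lemma center_class : vertex_class v0 = coker_class L y *+ r v0.
Proof.
rewrite raddf_sum -[LHS]mulr1z -c_sum -sumrMnl mulrz_sumr.
apply: eq_bigr => j _.
rewrite raddfMz /= -/(vertex_class _) pmulrn mulrzAC -pmulrn leaf_class_mul.
by rewrite mulrC mulrzA.
Qed.

(** The form [weighted_sum r] vanishes on the image of [L] and has values in a torsion-free group.
    Conversely, [r v0] times the class of [z] is [weighted_sum r z] times the class of [v0]. *)
Lemma coker_torsion z :
  coker_class L z \in @torsion _ <-> weighted_sum r z = 0.
Proof.
split=> [/asboolP[n n0]|z0].
  rewrite -raddfMn => /coker_class_eq0[x] /(congr1 (weighted_sum r)).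
  rewrite weighted_sum_im raddfMn /= -mulr_natr natz => /eqP.
  by rewrite mulf_eq0 => /orP[/eqP //|]; case: n n0.
apply/asboolP; exists (r v0) => //; rewrite vertex_class_sum -sumrMnl.
under eq_bigr do rewrite pmulrn mulrzAC -pmulrn vertex_class_mul pmulrn -mulrzA.
by rewrite -mulrz_sumr -/(weighted_sum r z) z0.
Qed.

(* The classes of the leaves and of [v0] generate the cokernel, and
   [arm_order j] times the class of the leaf [v j] is the class of [v0]. *)
Lemma arm_coord_kernel z : (forall j, (arm_order j %| arm_coord j z)%Z) ->
  exists m : int, coker_class L z = coker_class L y *~ (m * r v0).
Proof.
move=> hz.
suff [m ->] : exists m : int, coker_class L z = vertex_class v0 *~ m.
  by exists m; rewrite center_class mulrzA pmulrn -!mulrzA mulrC.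
have -> : coker_class L z = vertex_class v0 *~ entry v0 z +
    \sum_j vertex_class (v j) *~ arm_coord j z.
  rewrite vertex_class_sum (bigD1 v0) //=; congr (_ + _).
  under eq_bigr => w w0.
    rewrite (harmonic_arm_weight w0 vertex_class_harmonic) mulrz_suml.
  over.
  rewrite exchange_big; apply: eq_bigr => j _.
  rewrite /arm_coord /weighted_sum [in RHS](bigD1 v0) //= arm_weight_center.
  rewrite mul0r add0r mulrz_sumr; apply: eq_bigr => w _.
  by rewrite pmulrn -mulrzA.
exists (entry v0 z + \sum_j (arm_coord j z %/ arm_order j)%Z).
rewrite mulrzDr mulrz_sumr; congr (_ + _); apply: eq_bigr => j _.
rewrite -{1}(divzK (hz j)) mulrC mulrzA -pmulrn.
by rewrite -(harmonic_center j vertex_class_harmonic).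
Qed.

(** * Projection along the center weights and the isomorphism *)

Let phi (g : 'I_l -> int) := \sum_j t j * (r (v j))%:Z * g j.

Let phiB f g : phi (fun j => f j - g j) = phi f - phi g.
Proof. by rewrite /phi -sumrB; apply: eq_bigr => j _; rewrite mulrBr. Qed.

Let phi_center m : (r v0 %| m - phi (fun j => m * (center_weight j)%:Z))%Z.
Proof.
have -> : phi (fun j => m * (center_weight j)%:Z) =
    m * \sum_j t j * (r (v j) * center_weight j)%N%:Z.
  rewrite mulr_sumr; apply: eq_bigr => j _; rewrite PoszM; ring.
rewrite -[X in X - _]mulr1 -mulrBr dvdz_mull // -eqz_mod_dvd; apply/eqP.
by rewrite t_sum.
Qed.

(** The factor [r (v j)] in [phi] turns multiples of [arm_order j] into multiples of [r v0], so
    [phi] descends to [G -> Z / r v0]. *)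
Let phi_order g : (forall j, (arm_order j %| g j)%Z) -> (r v0 %| phi g)%Z.
Proof.
move=> hg; apply: rpred_sum => j _; rewrite -mulrA dvdz_mull //.
by rewrite -(arm_orderK j) PoszM mulrC dvdz_mul.
Qed.

(* [phi] maps [center_weight] to [1] modulo [r v0]; [psi u s] is the projection
   of [arm_coord^~ u] along [center_weight] onto the kernel of [phi], plus [s]
   times [center_weight]. *)
Let psi u s j :=
  arm_coord j u + (s - phi (arm_coord^~ u)) * (center_weight j)%:Z.

Let psiB u u' s s' j : psi (u - u') (s - s') j = psi u s j - psi u' s' j.
Proof.
rewrite /psi (_ : phi _ = phi (arm_coord^~ u) - phi (arm_coord^~ u')).
  by rewrite /arm_coord raddfB; ring.
by rewrite -phiB; apply: eq_bigr => k _; rewrite /arm_coord raddfB.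
Qed.

Let phi_psi u s : (r v0 %| s - phi (psi u s))%Z.
Proof.
pose m := s - phi (arm_coord^~ u).
have -> : s - phi (psi u s) = m - phi (fun j => m * (center_weight j)%:Z).
  have -> : phi (psi u s) =
      phi (arm_coord^~ u) + phi (fun j => m * (center_weight j)%:Z).
    by rewrite /phi -big_split; apply: eq_bigr => j _; rewrite /= -mulrDr.
  by rewrite /m; ring.
exact: phi_center.
Qed.

Let arm_order_dvd j : (arm_order j %| Posz (r v0))%Z.
Proof. by apply/dvdnP; exists (r (v j)); rewrite mulnC arm_orderK. Qed.

(** Up to multiples of [arm_order], the coordinates of the first argument are a multiple of
    [center_weight], which the projection kills. *)
Let psi_im x s s' j : (r v0 %| s)%Z -> (r v0 %| s')%Z ->
  (arm_order j %| psi (L *m x + y *~ s) s' j)%Z.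
Proof.
move=> hs hs'; pose u := L *m x + y *~ s; pose b k := (center_weight k)%:Z.
have hu k : (arm_order k %| arm_coord k u + entry v0 x * b k)%Z.
  rewrite /u /arm_coord raddfD raddfMz addrAC /= mulrC rpredD ?arm_coord_im //.
  by rewrite mulrzz dvdz_mull // (dvdz_trans (arm_order_dvd k)).
rewrite /psi -/u -/(b j).
have -> : arm_coord j u + (s' - phi (arm_coord^~ u)) * b j =
   (arm_coord j u + entry v0 x * b j) +
   (s' - phi (fun k => arm_coord k u + entry v0 x * b k)
    - (entry v0 x - phi (fun k => entry v0 x * b k))) * b j.
  have -> : phi (fun k => arm_coord k u + entry v0 x * b k) =
      phi (arm_coord^~ u) + phi (fun k => entry v0 x * b k).
    by rewrite /phi -big_split; apply: eq_bigr => k _; rewrite /= -mulrDr.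
  ring.
rewrite rpredD // dvdz_mulr // (dvdz_trans (arm_order_dvd j)) //.
by rewrite rpredB ?phi_center // rpredB // phi_order.
Qed.

Local Notation cl n := (quot_class (dvdz n : {pred int})).

Lemma critical_group_splitting :
  group_iso (critical_group e d r * (Zmod (r v0) * Zmod (r v0)))%type
    (dsum (fun j => Zmod (arm_order j))).
Proof.
pose K := critical_group e d r.
(* The critical group and the first [Z / r v0] are joined in [z + y *~ s]; the second one supplies
   the component along [center_weight]. *)
pose R (a : K * (Zmod (r v0) * Zmod (r v0))) (g : dsum _) :=
  exists z s s', [/\ val a.1 = coker_class L z, a.2.1 = cl (r v0) s,
    a.2.2 = cl (r v0) s' &
    forall j, g j = cl (arm_order j) (psi (z + y *~ s) s' j)].
apply: (@group_iso_relation _ _ R).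
- move=> [k [a b]].
  have [z kz] := quot_classP (val k : Quotient.quot (mx_im L)).
  have [s as_] := quot_classP a; have [s' bs'] := quot_classP b.
  exists [ffun j => cl _ (psi (z + y *~ s) s' j)], z, s, s'; split=> // j.
  by rewrite ffunE.
- move=> g.
  have /choice[f fP] j : exists x, g j = cl (arm_order j) x.
    exact: quot_classP.
  (* A preimage of [f]: [u] has arm coordinates [f], subtracting [y *~ s] makes its class torsion,
     and the last component [phi f] cancels the correction term in [psi]. *)
  pose u : 'cV[int]_#|V| := \sum_j vertex_unit (v j) *~ f j.
  pose s := weighted_sum r u.
  have zT : coker_class L (u - y *~ s) \in @torsion _.
    by apply/coker_torsion; rewrite raddfB raddfMz /= weighted_sum_y intz subrr.
  exists (Sub (coker_class L (u - y *~ s)) zT, (cl _ s, cl _ (phi f))).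
  exists (u - y *~ s), s, (phi f); split=> // j.
  rewrite fP subrK /psi.
  have uf k : arm_coord k u = f k.
    rewrite /arm_coord raddf_sum (bigD1 k) //= big1 => [|i /negPf ik].
      by rewrite raddfMz /= weighted_sum_unit arm_weight_leaf eqxx addr0 intz.
    by rewrite raddfMz /= weighted_sum_unit arm_weight_leaf eq_sym ik mul0rz.
  rewrite uf (_ : phi (arm_coord^~ u) = phi f) ?subrr ?mul0r ?addr0 //.
  by apply: eq_bigr => k _; rewrite uf.
- move=> a a' g g' [z [s [s' [h1 h2 h3 h4]]]] [z1 [s1 [s1' [k1 k2 k3 k4]]]].
  exists (z - z1), (s - s1), (s' - s1').
  split; rewrite ?raddfB /= -?h1 -?k1 -?h2 -?k2 -?h3 -?k3 //.
  move=> j; rewrite dsumBE h4 k4 -raddfB -psiB; congr (cl _ (psi _ _ _)).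
  by rewrite opprD addrACA.
- move=> g [z [s [s' [h1 h2 h3 h4]]]]; apply/ffunP => j; rewrite h4 dsum0E.
  have [x ->] : exists x, z = L *m x by apply/coker_class_eq0; rewrite -h1.
  by apply/quot_class_eq0/psi_im; apply/quot_class_eq0.
move=> [k [a b]] [z [s [s' [/= h1 h2 h3 h4]]]].
have D j : (arm_order j %| psi (z + y *~ s) s' j)%Z.
  by apply/quot_class_eq0; rewrite -[LHS]h4 dsum0E.
have z0 : weighted_sum r z = 0 by apply/coker_torsion; rewrite -h1; apply: valP.
have b0 : b = 0.
  rewrite h3; apply/quot_class_eq0.
  rewrite -(subrK (phi (psi (z + y *~ s) s')) s').
  by apply: rpredD; [exact: phi_psi | exact: phi_order].
(* [m] is the multiple of [center_weight] added in [psi]. Subtracting [L *m x], with [x] equal to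
   [m] at [v0] and 0 elsewhere, absorbs it and leaves arm coordinates divisible by [arm_order]. *)
pose m := s' - phi (arm_coord^~ (z + y *~ s)).
pose x := vertex_unit v0 *~ m.
have [n hn] : exists n : int,
    coker_class L (z + y *~ s - L *m x) = coker_class L y *~ (n * r v0).
  apply: arm_coord_kernel => j.
  rewrite -(_ : psi (z + y *~ s) s' j -
    (arm_coord j (L *m x) + (center_weight j)%:Z * entry v0 x) =
    arm_coord j (z + y *~ s - L *m x)).
    by rewrite rpredB ?arm_coord_im.
  have -> : entry v0 x = m by rewrite raddfMz /= entry_unit eqxx intz.
  by rewrite /psi -/m /arm_coord [RHS]raddfB /=; ring.
have Lx0 : coker_class L (L *m x) = 0 by apply/coker_class_eq0; exists x.
have [x' hx'] : exists x', z + y *~ (s - n * r v0) = L *m x'.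
  apply/coker_class_eq0; rewrite mulrzBr addrA raddfB /= [X in _ - X]raddfMz /=.
  by rewrite -hn raddfB /= Lx0 subr0 subrr.
(* The form [weighted_sum r] is 0 at [z] and on the image of [L], and 1 at [y]. *)
have sn : s = n * r v0.
  move/(congr1 (weighted_sum r)): hx'.
  rewrite weighted_sum_im raddfD /= z0 add0r raddfMz /= weighted_sum_y intz.
  by move/eqP; rewrite subr_eq0 => /eqP.
congr (_, (_, _)) => //; last first.
  by rewrite h2; apply/quot_class_eq0; rewrite sn dvdz_mull.
apply: val_inj; rewrite /= h1; apply/coker_class_eq0; exists x'.
by rewrite -hx' sn subrr mulr0z addr0.
Qed.

End StarlikeTrees.

(* MathComp world. The quotient r v0 %/ r (v i) is exact: along the arm from
   v0 to a leaf, the value of r at the leaf divides every other value. *)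
Theorem theorem6p4 (V : finType) (e : rel V) (v0 : V) (l : nat)
    (v : 'I_l -> V) (d r : V -> nat)
    (hS : starlike_tree e v0)
    (v_inj : injective v)
    (v_leaf : forall w : V, leaf e w <-> exists i : 'I_l, v i = w)
    (hdr : arithmetical_structure e d r) :
  group_iso
    (critical_group e d r * (Zmod (r v0) * Zmod (r v0)))%type
    (dsum (fun i : 'I_l => Zmod (r v0 %/ r (v i)))).
Proof.
have [c c_sum] := bezout_leaves hS v_inj v_leaf hdr.
have [t t_sum] := bezout_center_weights hS v_inj v_leaf hdr.
exact: (critical_group_splitting hS v_inj v_leaf hdr c_sum t_sum).
Qed.
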